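(* In the two-parameter quantum group $U_{r,s}(\mathfrak{sp}_4)$ (type $C_2$), put $$\mathcal T_1(e_2)=e_2e_1^{(2)}-s^{-1}e_1e_2e_1+r^{-1}s^{-3}e_1^{(2)}e_2,\qquad \mathcal T_1'(e_2)=e_1e_2-s^2e_2e_1,\qquad \mathcal T_2(e_1)=e_1e_2-r^2e_2e_1 .$$ Then the following identities hold: $$\mathcal T_1(e_2)\,\mathcal T_1'(e_2)=r^2\,\mathcal T_1'(e_2)\,\mathcal T_1(e_2),$$ $$e_1\,\mathcal T_2(e_1)^2-s(r+s)\,\mathcal T_2(e_1)\,e_1\,\mathcal T_2(e_1)+rs^3\,\mathcal T_2(e_1)^2\,e_1=0 .$$
   Context: Base field: $\mathbb K=\mathbb Q(r,s)$, where $r,s$ are either two indeterminates, or nonzero parameters in $\mathbb C$ with $r^2\ne s^2$. The divided power is $e_1^{(2)}=e_1^2/(r^{-1}+s^{-1})$. $U_{r,s}(\mathfrak{sp}_4)$ is the unital associative $\mathbb K$-algebra generated by $e_i,f_i,\omega_i^{\pm1},\omega_i'^{\pm1}$ ($i=1,2$) with relations: the $\omega_i^{\pm1},\omega_j'^{\pm1}$ commute and $\omega_i\omega_i^{-1}=\omega_i'\omega_i'^{-1}=1$; with $p_{11}=rs^{-1}$, $p_{12}=r^{-2}$, $p_{21}=s^2$, $p_{22}=r^2s^{-2}$, $$\omega_je_i\omega_j^{-1}=p_{ij}e_i,\quad \omega_jf_i\omega_j^{-1}=p_{ij}^{-1}f_i,\quad \omega_j'e_i\omega_j'^{-1}=p_{ji}^{-1}e_i,\quad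 \omega_j'f_i\omega_j'^{-1}=p_{ji}f_i;$$ $[e_i,f_j]=\delta_{ij}\frac{\omega_i-\omega_i'}{r_i-s_i}$ with $r_1=r,s_1=s,r_2=r^2,s_2=s^2$; and the $(r,s)$-Serre relations $$e_1^3e_2-(r^2+rs+s^2)e_1^2e_2e_1+rs(r^2+rs+s^2)e_1e_2e_1^2-(rs)^3e_2e_1^3=0,$$ $$e_2^2e_1-(r^{-2}+s^{-2})e_2e_1e_2+r^{-2}s^{-2}e_1e_2^2=0,$$ $$f_2f_1^3-(r^2+rs+s^2)f_1f_2f_1^2+rs(r^2+rs+s^2)f_1^2f_2f_1-(rs)^3f_1^3f_2=0,$$ $$f_1f_2^2-(r^{-2}+s^{-2})f_2f_1f_2+r^{-2}s^{-2}f_2^2f_1=0.$$ *)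

(* Defs.v *)
From HB Require Import structures.
From mathcomp Require Import all_boot all_algebra.
From mathcomp Require Import boolp reals complex monalg.

Set Implicit Arguments.
Unset Strict Implicit.
Unset Printing Implicit Defensive.

Import GRing.Theory.
Local Open Scope ring_scope.
Local Open Scope quotient_scope.

(* The two allowed meanings of K = Q(r, s). First case: r and s are
   indeterminates, Q[r, s] being encoded as {poly {poly rat}} with r the inner
   variable and s the outer one. Second case: r and s are complex numbers, and K
   is (via iota) a subfield of C with no proper subfield containing r and s. *)
Variant base_field (R : realType) : forall K : fieldType, K -> K -> Prop :=
| Indeterminates :
    @base_field R {fraction {poly {poly rat}}}
      (FracField.tofrac ('X : {poly rat})%:P) (FracField.tofrac 'X)
| ComplexNumbers (K : fieldType) (iota : {rmorphism K -> R[i]}) (r s : K) :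
    r != 0 -> s != 0 -> r ^+ 2 != s ^+ 2 ->
    (forall S : {pred K}, divring_closed S -> r \in S -> s \in S ->
       forall x, x \in S) ->
    base_field R r s.

Notation idx1 := (@Ordinal 2 0 isT).
Notation idx2 := (@Ordinal 2 1 isT).

(* [Gw i], [GwV i], [Gw' i], [GwV' i] stand for omega_i, omega_i^-1, omega'_i,
   omega'_i^-1. *)
Variant generator : Type :=
| Ge of 'I_2 | Gf of 'I_2 | Gw of 'I_2 | GwV of 'I_2
| Gw' of 'I_2 | GwV' of 'I_2.

HB.instance Definition _ := gen_eqMixin generator.
HB.instance Definition _ := gen_choiceMixin generator.

Definition toral (g : generator) : bool :=
  match g with Ge _ | Gf _ => false | _ => true end.

(* The monoid algebra of the free monoid, that is, the free algebra. *)
Definition freeAlg (K : fieldType) : Type := {malg K[{fmonom generator}]}.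

Section FreeAlgebra.
Variable K : fieldType.

HB.instance Definition _ := GRing.Lalgebra.on (freeAlg K).

Definition gen (g : generator) : freeAlg K := << fmu g >>.

Lemma malg_scalerAr (c : K) (x y : {malg K[{fmonom generator}]}) :
  c *: (x * y) = x * (c *: y).
Proof.
have cC : c%:MP * x = x * c%:MP.
  rewrite malgM_def [RHS]malgM_def fgmulgU fgmulUg.
  by apply: eq_bigr => m _; rewrite mulrC mul1m mulm1.
rewrite -(mul_malgC c (x * y)) -(mul_malgC c y) (mulrA c%:MP x y) cC.
rewrite -(mulrA x c%:MP y).
reflexivity.
Qed.

HB.instance Definition _ :=
  GRing.Lalgebra_isAlgebra.Build K (freeAlg K) malg_scalerAr.

End FreeAlgebra.

Section Relations.
Variables (K : fieldType) (r s : K).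

Definition p_ (i j : 'I_2) : K :=
  if i == idx1 then (if j == idx1 then r / s else r ^- 2)
  else (if j == idx1 then s ^+ 2 else r ^+ 2 / s ^+ 2).

Definition r_ (i : 'I_2) : K := if i == idx1 then r else r ^+ 2.
Definition s_ (i : 'I_2) : K := if i == idx1 then s else s ^+ 2.

Variables (A : algType K) (gen : generator -> A).

Local Notation e := (fun i => gen (Ge i)).
Local Notation f := (fun i => gen (Gf i)).
Local Notation w := (fun i => gen (Gw i)).
Local Notation wV := (fun i => gen (GwV i)).
Local Notation w' := (fun i => gen (Gw' i)).
Local Notation wV' := (fun i => gen (GwV' i)).

Local Notation t := (r ^+ 2 + r * s + s ^+ 2).
Local Notation u := (r ^- 2 + s ^- 2).
Local Notation v := (r ^- 2 * s ^- 2).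

(* [Urs_rel x] states that x = 0 is a defining relation of U_{r,s}(sp_4). *)
Inductive Urs_rel : A -> Prop :=
| rel_comm g h : toral g -> toral h ->
    Urs_rel (gen g * gen h - gen h * gen g)
| rel_wwV i : Urs_rel (w i * wV i - 1)
| rel_wwV' i : Urs_rel (w' i * wV' i - 1)
| rel_we i j : Urs_rel (w j * e i * wV j - p_ i j *: e i)
| rel_wf i j : Urs_rel (w j * f i * wV j - (p_ i j)^-1 *: f i)
| rel_we' i j : Urs_rel (w' j * e i * wV' j - (p_ j i)^-1 *: e i)
| rel_wf' i j : Urs_rel (w' j * f i * wV' j - p_ j i *: f i)
| rel_ef i j : Urs_rel (e i * f j - f j * e i -
    (if i == j then (r_ i - s_ i)^-1 *: (w i - w' i) else 0))
| rel_serre_e12 : Urs_rel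
    (e idx1 ^+ 3 * e idx2 - t *: (e idx1 ^+ 2 * e idx2 * e idx1)
     + (r * s * t) *: (e idx1 * e idx2 * e idx1 ^+ 2)
     - (r * s) ^+ 3 *: (e idx2 * e idx1 ^+ 3))
| rel_serre_e21 : Urs_rel
    (e idx2 ^+ 2 * e idx1 - u *: (e idx2 * e idx1 * e idx2) + v *: (e idx1 * e idx2 ^+ 2))
| rel_serre_f12 : Urs_rel
    (f idx2 * f idx1 ^+ 3 - t *: (f idx1 * f idx2 * f idx1 ^+ 2)
     + (r * s * t) *: (f idx1 ^+ 2 * f idx2 * f idx1)
     - (r * s) ^+ 3 *: (f idx1 ^+ 3 * f idx2))
| rel_serre_f21 : Urs_rel
    (f idx1 * f idx2 ^+ 2 - u *: (f idx2 * f idx1 * f idx2) + v *: (f idx2 ^+ 2 * f idx1)).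

(* The values of the counit of the Hopf algebra on the generators. *)
Lemma counit_rel (eps : {rmorphism A -> K}) (x : A) :
  (forall c y, eps (c *: y) = c * eps y) ->
  (forall g, eps (gen g) = (toral g)%:R) -> Urs_rel x -> eps x = 0.
Proof.
move=> epsZ epsG; have cE := (rmorphB, rmorphD, epsZ, rmorphM, rmorphXn, rmorph1).
have zE := (expr0n, mul0r, mulr0, mulr1, subrr, subr0, addr0).
case=> [g h gT hT|i|i|i j|i j|i j|i j|i j||||]; rewrite ?cE /= ?epsG /=
  ?gT ?hT ?zE ?add0r ?oppr0 //=.
by case: ifP => _; rewrite ?rmorph0 ?epsZ ?rmorphB /= ?epsG ?subrr ?mulr0 oppr0.
Qed.

End Relations.

Lemma Urs_rel_lift (K : fieldType) (r s : K) (A B : algType K)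
    (phi : {lrmorphism A -> B}) (g : generator -> A) (y : B) :
  Urs_rel r s (phi \o g) y -> exists2 x, Urs_rel r s g x & phi x = y.
Proof.
have phiZ c x : phi (c *: x) = c *: phi x by rewrite linearZ.
have phiD x y1 : phi (x + y1) = phi x + phi y1 by rewrite rmorphD.
have phiN x : phi (- x) = - phi x by rewrite rmorphN.
have phiM x y1 : phi (x * y1) = phi x * phi y1 by rewrite rmorphM.
have phiX x n : phi (x ^+ n) = phi x ^+ n by rewrite rmorphXn.
have phi1 : phi 1 = 1 by rewrite rmorph1.
have phiE := (phiD, phiN, phiZ, phiM, phiX, phi1).
case=> [h k hT kT|i|i|i j|i j|i j|i j|i j||||].
- by eexists; [exact: rel_comm hT kT | rewrite !phiE].
- by eexists; [exact: (rel_wwV _ _ _ i) | rewrite !phiE].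
- by eexists; [exact: (rel_wwV' _ _ _ i) | rewrite !phiE].
- by eexists; [exact: (rel_we _ _ _ i j) | rewrite !phiE].
- by eexists; [exact: (rel_wf _ _ _ i j) | rewrite !phiE].
- by eexists; [exact: (rel_we' _ _ _ i j) | rewrite !phiE].
- by eexists; [exact: (rel_wf' _ _ _ i j) | rewrite !phiE].
- eexists; [exact: (rel_ef _ _ _ i j) | rewrite !phiE /=].
  by case: ifP => _; rewrite ?phiE ?rmorph0.
- by eexists; [exact: rel_serre_e12 | rewrite !phiE].
- by eexists; [exact: rel_serre_e21 | rewrite !phiE].
- by eexists; [exact: rel_serre_f12 | rewrite !phiE].
- by eexists; [exact: rel_serre_f21 | rewrite !phiE].
Qed.

Section Presentation.
Variables (K : fieldType) (r s : K).

Local Notation A := (freeAlg K).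

(* The two-sided ideal generated by the relations; it is closed under opposites
   because A contains the scalars. *)
Inductive Urs_ideal : A -> Prop :=
| ideal_rel x : Urs_rel r s (@gen K) x -> Urs_ideal x
| ideal0 : Urs_ideal 0
| idealD x y : Urs_ideal x -> Urs_ideal y -> Urs_ideal (x + y)
| idealMl a x : Urs_ideal x -> Urs_ideal (a * x)
| idealMr x a : Urs_ideal x -> Urs_ideal (x * a).

Definition in_ideal (x : A) : bool := `[< Urs_ideal x >].

Lemma in_idealP x : reflect (Urs_ideal x) (x \in in_ideal).
Proof. exact: asboolP. Qed.

Lemma in_ideal_zmod_closed : zmod_closed in_ideal.
Proof.
split=> [|x y /in_idealP Ix /in_idealP Iy]; apply/in_idealP; first exact: ideal0.
by apply: idealD => //; rewrite -mulN1r; apply: idealMl.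
Qed.

HB.instance Definition _ :=
  GRing.isZmodClosed.Build A in_ideal in_ideal_zmod_closed.

Definition counit_mon (m : {fmonom generator}) : K :=
  \prod_(g <- fmonom_val m) (toral g)%:R.

Lemma counit_mon_mmorphism : mmorphism counit_mon.
Proof.
split; last by rewrite /counit_mon fm1 big_nil.
by move=> m1 m2; rewrite /counit_mon fmM big_cat.
Qed.

HB.instance Definition _ :=
  isMultiplicative.Build _ _ counit_mon counit_mon_mmorphism.

Definition counit (x : A) : K := mmap idfun counit_mon x.

Fact counit_zmod_morphism : zmod_morphism counit.
Proof. exact: mmapB. Qed.

Fact counit_monoid_morphism : monoid_morphism counit.
Proof.
split; first exact: mmap1.
exact: (@rmorphM _ _ (mmap idfun counit_mon : {malg K[_]} -> K)).
Qed.

HB.instance Definition _ :=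
  GRing.isZmodMorphism.Build A K counit counit_zmod_morphism.
HB.instance Definition _ :=
  GRing.isMonoidMorphism.Build A K counit counit_monoid_morphism.

Lemma counit_ideal (x : A) : Urs_ideal x -> counit x = 0.
Proof.
elim=> {x} [x||x y _ xE _ yE|a x _ IH|x a _ IH].
- apply: counit_rel => [c y|g]; first exact: mmapZ.
  by rewrite /= /counit mmapU mul1r /counit_mon fmU big_seq1.
- exact: rmorph0.
- by rewrite rmorphD /= xE yE addr0.
- by rewrite rmorphM /= IH mulr0.
- by rewrite rmorphM /= IH mul0r.
Qed.

(* U_{r,s} is nonzero, which the interface of algebras requires. *)
Fact one_notin_ideal : 1 \notin in_ideal.
Proof.
by apply/in_idealP => /counit_ideal /eqP; rewrite rmorph1 oner_eq0.
Qed.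

Definition Urs : Type := Quotient.quot (GRing.ZmodClosed.clone A in_ideal _).
HB.instance Definition _ := EqQuotient.on Urs.
HB.instance Definition _ := GRing.Zmodule.on Urs.

Definition Urs_pi (x : A) : Urs := \pi_Urs x.

Lemma Urs_pi_eq (x y : A) : Urs_pi x = Urs_pi y <-> Urs_ideal (x - y).
Proof.
split=> [/eqP xy|/in_idealP]; last by rewrite Quotient.idealrBE => /eqP.
by apply/in_idealP; rewrite Quotient.idealrBE.
Qed.

Lemma Urs_pi_repr (x : Urs) : Urs_pi (repr x) = x.
Proof. exact: reprK. Qed.

Lemma repr_Urs_pi (x : A) : Urs_ideal (repr (Urs_pi x) - x).
Proof. by apply/Urs_pi_eq; rewrite Urs_pi_repr. Qed.

Fact Urs_pi_zmod_morphism : zmod_morphism Urs_pi.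
Proof.
exact: (raddfB (\pi_(Quotient.quot (GRing.ZmodClosed.clone A in_ideal _)))).
Qed.
HB.instance Definition _ :=
  GRing.isZmodMorphism.Build A Urs Urs_pi Urs_pi_zmod_morphism.

Definition Urs_one : Urs := Urs_pi 1.
Definition Urs_mul (x y : Urs) : Urs := Urs_pi (repr x * repr y).
Definition Urs_scale (c : K) (x : Urs) : Urs := Urs_pi (c *: repr x).

Lemma Urs_mulE (x y : A) : Urs_mul (Urs_pi x) (Urs_pi y) = Urs_pi (x * y).
Proof.
apply/Urs_pi_eq.
set x' := repr _; set y' := repr _.
have -> : x' * y' - x * y = (x' - x) * y' + x * (y' - y).
  by rewrite mulrBl mulrBr addrA subrK.
by apply: idealD; [apply: idealMr | apply: idealMl]; apply: repr_Urs_pi.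
Qed.

Lemma Urs_scaleE c (x : A) : Urs_scale c (Urs_pi x) = Urs_pi (c *: x).
Proof.
apply/Urs_pi_eq; rewrite -scalerBr -mulr_algl.
by apply: idealMl; apply: repr_Urs_pi.
Qed.

Lemma Urs_ind (P : Urs -> Prop) : (forall x : A, P (Urs_pi x)) -> forall x, P x.
Proof. by move=> P_pi x; rewrite -(Urs_pi_repr x). Qed.

Fact Urs_mulA : associative Urs_mul.
Proof.
elim/Urs_ind=> x; elim/Urs_ind=> y; elim/Urs_ind=> z.
by rewrite !Urs_mulE mulrA.
Qed.
Fact Urs_mul1r : left_id Urs_one Urs_mul.
Proof. by elim/Urs_ind=> x; rewrite Urs_mulE mul1r. Qed.
Fact Urs_mulr1 : right_id Urs_one Urs_mul.
Proof. by elim/Urs_ind=> x; rewrite Urs_mulE mulr1. Qed.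
Fact Urs_mulDl : left_distributive Urs_mul +%R.
Proof.
elim/Urs_ind=> x; elim/Urs_ind=> y; elim/Urs_ind=> z.
by rewrite -raddfD !Urs_mulE -raddfD -mulrDl.
Qed.
Fact Urs_mulDr : right_distributive Urs_mul +%R.
Proof.
elim/Urs_ind=> x; elim/Urs_ind=> y; elim/Urs_ind=> z.
by rewrite -raddfD !Urs_mulE -raddfD -mulrDr.
Qed.
Fact Urs_one_neq0 : Urs_one != 0.
Proof.
apply/eqP; rewrite -(raddf0 Urs_pi) => /Urs_pi_eq /in_idealP.
by rewrite subr0 (negPf one_notin_ideal).
Qed.

HB.instance Definition _ := GRing.Zmodule_isNzRing.Build Urs
  Urs_mulA Urs_mul1r Urs_mulr1 Urs_mulDl Urs_mulDr Urs_one_neq0.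

Fact Urs_scalerA a b x : Urs_scale a (Urs_scale b x) = Urs_scale (a * b) x.
Proof. by elim/Urs_ind: x => x; rewrite !Urs_scaleE scalerA. Qed.
Fact Urs_scale1r : left_id 1 Urs_scale.
Proof. by elim/Urs_ind=> x; rewrite Urs_scaleE scale1r. Qed.
Fact Urs_scalerDr : right_distributive Urs_scale +%R.
Proof.
move=> a; elim/Urs_ind=> x; elim/Urs_ind=> y.
by rewrite -raddfD !Urs_scaleE -raddfD -scalerDr.
Qed.
Fact Urs_scalerDl x : {morph Urs_scale^~ x : a b / a + b}.
Proof.
by elim/Urs_ind: x => x a b; rewrite !Urs_scaleE scalerDl raddfD.
Qed.

HB.instance Definition _ := GRing.Zmodule_isLmodule.Build K Urs
  Urs_scalerA Urs_scale1r Urs_scalerDr Urs_scalerDl.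

Fact Urs_scalerAl (a : K) (x y : Urs) : a *: (x * y) = (a *: x) * y.
Proof.
elim/Urs_ind: x => x; elim/Urs_ind: y => y.
rewrite /GRing.mul /GRing.scale /=.
by rewrite Urs_mulE !Urs_scaleE Urs_mulE -scalerAl.
Qed.
HB.instance Definition _ := GRing.Lmodule_isLalgebra.Build K Urs Urs_scalerAl.

Fact Urs_scalerAr (a : K) (x y : Urs) : a *: (x * y) = x * (a *: y).
Proof.
elim/Urs_ind: x => x; elim/Urs_ind: y => y.
rewrite /GRing.mul /GRing.scale /=.
by rewrite Urs_mulE !Urs_scaleE Urs_mulE -scalerAr.
Qed.
HB.instance Definition _ := GRing.Lalgebra_isAlgebra.Build K Urs Urs_scalerAr.

Fact Urs_pi_monoid_morphism : monoid_morphism Urs_pi.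
Proof.
split; first exact: erefl.
move=> x y.
exact: esym (Urs_mulE x y).
Qed.
HB.instance Definition _ :=
  GRing.isMonoidMorphism.Build A Urs Urs_pi Urs_pi_monoid_morphism.

Fact Urs_pi_scalable : scalable Urs_pi.
Proof. by move=> c x; rewrite -Urs_scaleE. Qed.
HB.instance Definition _ :=
  GRing.isScalable.Build K A Urs *:%R Urs_pi Urs_pi_scalable.

Definition Urs_gen (g : generator) : Urs := Urs_pi (gen K g).

Lemma Urs_gen_rel (x : Urs) : Urs_rel r s Urs_gen x -> x = 0.
Proof.
move=> /(@Urs_rel_lift _ _ _ _ _ (Urs_pi : {lrmorphism A -> Urs}) (@gen K)).
case=> a aR <-; rewrite -(raddf0 Urs_pi); apply/Urs_pi_eq.
by rewrite subr0; apply: ideal_rel.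
Qed.

End Presentation.

Section RootVectors.
Variables (K : fieldType) (r s : K).

Definition Urs_e (i : 'I_2) : Urs r s := Urs_gen r s (Ge i).

(* The divided power of e_1. *)
Definition e1_div2 : Urs r s := (r^-1 + s^-1)^-1 *: Urs_e idx1 ^+ 2.

Definition T1_e2 : Urs r s :=
  Urs_e idx2 * e1_div2 - s^-1 *: (Urs_e idx1 * Urs_e idx2 * Urs_e idx1)
  + (r^-1 * s ^- 3) *: (e1_div2 * Urs_e idx2).

Definition T1'_e2 : Urs r s := Urs_e idx1 * Urs_e idx2 - s ^+ 2 *: (Urs_e idx2 * Urs_e idx1).

Definition T2_e1 : Urs r s := Urs_e idx1 * Urs_e idx2 - r ^+ 2 *: (Urs_e idx2 * Urs_e idx1).

End RootVectors.

(* Main.v *)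
Require Import Defs.
From mathcomp Require Import all_boot all_algebra.
From mathcomp Require Import reals.
From mathcomp Require Import ring.

Set Implicit Arguments.
Unset Strict Implicit.
Unset Printing Implicit Defensive.

Import GRing.Theory.
Local Open Scope ring_scope.

(** Write [qcomm q x y] for the q-commutator xy - q yx, and let a = e_1, b = e_2.
    Since r^2, rs, s^2 are the roots of the polynomial whose coefficients occur
    in the cubic Serre relation, and r^2, s^2 those for the quadratic one, the
    two relations are iterated q-commutators: with y = [a, b]_(s^2) and
    z = [a, y]_(rs), they say that az = r^2 za and yb = r^2 by. Here y is
    T_1'(e_2), and z is a nonzero multiple of T_1(e_2).

    The words in b, y, z, a thus can be straightened, and all that is missing is
    the exchange of z and y. It comes from an overlap (a diamond-lemma
    computation): first, zb = r(r - s) y^2 + r^2 s^2 bz; then the word azb,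
    straightened from the left and from the right, gives two expressions that
    differ by rs (r^2 yz - zy). Hence zy = r^2 yz ([qcomm_root_vectors]), which
    is the first identity.

    Operators [a, -]_p and [a, -]_q commute, so both Serre relations are
    symmetric in r and s. The second identity is the first with r and s
    exchanged, expanded in terms of a and T_2(e_1) = [a, b]_(r^2) by means of
    z = [a, y]_(rs). *)

Section QCommutators.
Variables (K : fieldType) (A : algType K).
Implicit Types (p q t r s : K) (a b x y z : A).

Definition qcomm q x y : A := x * y - q *: (y * x).

Lemma qcomm_eq0 q x y : qcomm q x y = 0 -> x * y = q *: (y * x).
Proof. by move/eqP; rewrite subr_eq0 => /eqP. Qed.

Lemma mul_qcomm q x y : x * y = qcomm q x y + q *: (y * x).
Proof. by rewrite subrK. Qed.

Lemma qcomm_qcomm p q a x :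
  qcomm p a (qcomm q a x) =
    a ^+ 2 * x - (p + q) *: (a * x * a) + (p * q) *: (x * a ^+ 2).
Proof.
rewrite /qcomm !(mulrBr, mulrBl) -scalerAr -scalerAl scalerBr scalerA.
by rewrite scalerDl expr2 !mulrA !opprD opprK !addrA [LHS](ACl (1*3*2*4)%AC).
Qed.

Lemma qcommAC p q a x : qcomm p a (qcomm q a x) = qcomm q a (qcomm p a x).
Proof. by rewrite !qcomm_qcomm [p * q]mulrC [p + q]addrC. Qed.

Lemma qcomm_qcommr p q a x :
  qcomm p (qcomm q a x) x =
    a * x ^+ 2 - (p + q) *: (x * a * x) + (p * q) *: (x ^+ 2 * a).
Proof.
rewrite /qcomm !(mulrBr, mulrBl) -scalerAr -scalerAl scalerBr scalerA.
by rewrite scalerDl !expr2 !mulrA !opprD opprK !addrA [LHS](ACl (1*3*2*4)%AC).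
Qed.

Lemma qcomm_qcommrC p q a x :
  qcomm p (qcomm q a x) x = qcomm q (qcomm p a x) x.
Proof. by rewrite !qcomm_qcommr [p * q]mulrC [p + q]addrC. Qed.

Lemma qcomm_cubic p q t a x :
  qcomm p a (qcomm q a (qcomm t a x)) =
    a ^+ 3 * x - (p + q + t) *: (a ^+ 2 * x * a)
    + (p * q + p * t + q * t) *: (a * x * a ^+ 2) - (p * q * t) *: (x * a ^+ 3).
Proof.
rewrite qcomm_qcomm /qcomm !(mulrBr a, mulrBr (a ^+ 2), mulrBl) !scalerBr.
rewrite -!scalerAl -!scalerAr !scalerA !exprSr !expr0 !mul1r !mulrA.
rewrite !(opprD, opprK) !addrA [LHS](ACl (1*(3*2)*(4*5)*6)%AC) /=.
rewrite -!opprD -!scalerAl scalerA -!scalerDl.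
by congr (_ + _ *: _ - _); ring.
Qed.

(** The hypotheses let a pass z, and y pass b. Straightening the word azb into
    ordered words in b, y, z, a from the left and from the right must give the
    same result, and this forces z and y to q-commute as well. *)
Lemma qcomm_root_vectors r s a b (y := qcomm (s ^+ 2) a b)
    (z := qcomm (r * s) a y) :
  r != 0 -> s != 0 ->
  qcomm (r ^+ 2) a z = 0 -> qcomm (r ^+ 2) y b = 0 -> qcomm (r ^+ 2) z y = 0.
Proof.
move=> r0 s0 /qcomm_eq0 az /qcomm_eq0 yb.
have ab : a * b = y + s ^+ 2 *: (b * a) := mul_qcomm _ _ _.
have ay : a * y = z + (r * s) *: (y * a) := mul_qcomm _ _ _.
have zE : z = a * y - (r * s) *: (y * a) by [].
(* Opaque y and z keep the rewrite rules from seeing through them. *)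
clearbody y z.
have zb : z * b = (r * (r - s)) *: (y * y) + (r ^+ 2 * s ^+ 2) *: (b * z).
  rewrite [in LHS]zE mulrBl -scalerAl -!mulrA yb ab -scalerAr (mulrA a b) ab.
  rewrite mulrDr -scalerAr (mulrA y b) yb mulrDl -!scalerAl -!mulrA ay.
  rewrite mulrDr -scalerAr !(scalerDr, scalerA) !mulrA opprD !addrA.
  rewrite [LHS](ACl ((1*4)*2*(3*5))%AC) /= -!scaleNr -!scalerDl.
  (* The two contributions of the word bya cancel. *)
  rewrite [X in _ + X](_ : _ = 0) ?addr0.
    by congr (_ *: _ + _ *: _); ring.
  by rewrite -[RHS](scale0r (b * y * a)); congr (_ *: _); ring.
have azb_r : a * (z * b) = (r * (r - s)) *: (z * y)
    + (r ^+ 3 * s) *: (y * z)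
    + (r ^+ 3 * s ^+ 2 * (r - s)) *: (y * y * a)
    + (r ^+ 4 * s ^+ 4) *: (b * z * a).
  rewrite zb (mulrDr a) -!scalerAr !mulrA ab ay !mulrDl -!scalerAl -!mulrA ay az.
  rewrite (mulrDr y) -!scalerAr !(scalerDr, scalerA) !mulrA !addrA.
  rewrite [LHS](ACl (1*(2*4)*3*5)%AC) /= -!scalerDl.
  by congr (_ + _ *: _ + _ *: _ + _ *: _); ring.
have azb_l : a * z * b = (r ^+ 2) *: (z * y)
    + (r ^+ 3 * s ^+ 2 * (r - s)) *: (y * y * a)
    + (r ^+ 4 * s ^+ 4) *: (b * z * a).
  rewrite az -scalerAl -(mulrA z a b) ab (mulrDr z) -scalerAr (mulrA z b) zb.
  rewrite mulrDl -!scalerAl !(scalerDr, scalerA) !addrA.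
  by congr (_ + _ *: _ + _ *: _); ring.
move: azb_r; rewrite mulrA azb_l => /addIr/addIr.
move/eqP; rewrite eq_sym -subr_eq0 addrAC -scalerBl.
rewrite (_ : _ - _ = - (r * s)); last by ring.
rewrite (_ : r ^+ 3 * s = r * s * r ^+ 2); last by ring.
rewrite -scalerA scaleNr addrC -scalerBr scaler_eq0 mulf_eq0.
by rewrite (negPf r0) (negPf s0) /= => /eqP yz; rewrite /qcomm -opprB yz oppr0.
Qed.

Section SerreRelations.
Variables (r s : K) (a b : A).
Hypotheses (r0 : r != 0) (s0 : s != 0).

Hypothesis serre_ab :
  a ^+ 3 * b - (r ^+ 2 + r * s + s ^+ 2) *: (a ^+ 2 * b * a)
    + (r * s * (r ^+ 2 + r * s + s ^+ 2)) *: (a * b * a ^+ 2)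
    - (r * s) ^+ 3 *: (b * a ^+ 3) = 0.
Hypothesis serre_ba :
  b ^+ 2 * a - (r ^- 2 + s ^- 2) *: (b * a * b)
    + (r ^- 2 * s ^- 2) *: (a * b ^+ 2) = 0.

Lemma serre_ab_qcomm :
  qcomm (r ^+ 2) a (qcomm (r * s) a (qcomm (s ^+ 2) a b)) = 0.
Proof.
rewrite -serre_ab qcomm_cubic.
by congr (_ - _ + _ *: _ - _ *: _); ring.
Qed.

Lemma serre_ba_qcomm : qcomm (r ^+ 2) (qcomm (s ^+ 2) a b) b = 0.
Proof.
rewrite -(scaler0 _ (r ^+ 2 * s ^+ 2)) -serre_ba qcomm_qcommr.
rewrite !(scalerDr, scalerN) !scalerA [RHS](ACl (3*2*1)%AC) /=.
rewrite -[a * _ in LHS]scale1r.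
by congr (_ *: _ - _ *: _ + _); field; rewrite r0 s0.
Qed.

(** The left side is T_1(b). As the divided power is a^2 rs / (r + s), clearing
    denominators leaves the coefficients of X^2 - s(r + s) X + rs^3, whose roots
    are s^2 and rs. *)
Lemma T1_qcomm : r + s != 0 ->
  b * ((r^-1 + s^-1)^-1 *: a ^+ 2) - s^-1 *: (a * b * a)
    + (r^-1 * s ^- 3) *: ((r^-1 + s^-1)^-1 *: a ^+ 2 * b) =
  (s ^+ 2 * (r + s))^-1 *: qcomm (r * s) a (qcomm (s ^+ 2) a b).
Proof.
move=> rs0; rewrite qcomm_qcomm !(scalerDr, scalerN) !scalerA.
rewrite -scalerAl -scalerAr scalerA [LHS](ACl (3*2*1)%AC) /=.
by congr (_ *: _ - _ *: _ + _ *: _); field; rewrite ?r0 ?s0 ?rs0 // addrC.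
Qed.

Lemma serre_T1_T1' (y := a * b - s ^+ 2 *: (b * a))
    (T1b := b * ((r^-1 + s^-1)^-1 *: a ^+ 2) - s^-1 *: (a * b * a)
      + (r^-1 * s ^- 3) *: ((r^-1 + s^-1)^-1 *: a ^+ 2 * b)) :
  r + s != 0 -> T1b * y = r ^+ 2 *: (y * T1b).
Proof.
move=> rs0; rewrite /T1b T1_qcomm // -scalerAl -scalerAr.
have /qcomm_eq0 -> :=
  qcomm_root_vectors r0 s0 serre_ab_qcomm serre_ba_qcomm.
by rewrite !scalerA mulrC.
Qed.

(** This is [qcomm_root_vectors] with r and s exchanged: the orders of the
    iterated q-commutators in the Serre relations can be reversed. *)
Lemma serre_T2 (x := qcomm (r ^+ 2) a b) :
  a * x ^+ 2 - (s * (r + s)) *: (x * a * x) + (r * s ^+ 3) *: (x ^+ 2 * a) = 0.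
Proof.
have abx : qcomm (s ^+ 2) a (qcomm (s * r) a x) = 0.
  rewrite (mulrC s r) qcommAC (qcommAC (s ^+ 2)) (qcommAC (r * s)).
  exact: serre_ab_qcomm.
have xb : qcomm (s ^+ 2) x b = 0 by rewrite qcomm_qcommrC serre_ba_qcomm.
rewrite -(qcomm_root_vectors s0 r0 abx xb) qcomm_qcommr.
by congr (_ - _ *: _ + _ *: _); ring.
Qed.

End SerreRelations.
End QCommutators.

Lemma base_field_neq0 (R : realType) (K : fieldType) (r s : K) :
  base_field R r s -> [/\ r != 0, s != 0 & r + s != 0].
Proof.
case=> [|{}K _ {}r {}s r0 s0 rs _].
  rewrite -tofracD !tofrac_eq0 polyC_eq0 !polyX_eq0; split=> //.
  by rewrite addrC -size_poly_eq0 size_XaddC.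
split=> //; apply: contraNneq rs => /eqP.
by rewrite addr_eq0 => /eqP->; rewrite sqrrN.
Qed.

Theorem lemma3p6 (R : realType) (K : fieldType) (r s : K)
    (rs_base : base_field R r s) :
  T1_e2 r s * T1'_e2 r s = r ^+ 2 *: (T1'_e2 r s * T1_e2 r s) /\
  Urs_e r s idx1 * T2_e1 r s ^+ 2
    - (s * (r + s)) *: (T2_e1 r s * Urs_e r s idx1 * T2_e1 r s)
    + (r * s ^+ 3) *: (T2_e1 r s ^+ 2 * Urs_e r s idx1) = 0.
Proof.
have [r0 s0 rs0] := base_field_neq0 rs_base.
have serre_e12 := Urs_gen_rel (rel_serre_e12 r s (Urs_gen r s)).
have serre_e21 := Urs_gen_rel (rel_serre_e21 r s (Urs_gen r s)).
split; first exact: (serre_T1_T1' r0 s0 serre_e12 serre_e21 rs0).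
exact: (serre_T2 r0 s0 serre_e12 serre_e21).
Qed.
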